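(* Let $\mathcal{S}$ be an anti-negative semifield in which every invertible element has a square root (for example, the boolean semifield or the tropical semifield). Let $n$ be a positive integer and let $T:M_n(\mathcal{S})\to M_n(\mathcal{S})$ be a bijective $\mathcal{S}$-linear transformation. Then $T$ preserves $\mathcal{H}$ if and only if there exist invertible (monomial) matrices $P,Q\in M_n(\mathcal{S})$ such that either $T(X)=PXQ$ for all $X\in M_n(\mathcal{S})$ or $T(X)=PX^TQ$ for all $X\in M_n(\mathcal{S})$, where $X^T$ denotes the transpose of $X$. In particular, $T$ preserves $\mathcal{H}$ if and only if $T$ preserves $\mathcal{D}$.
   Context: A semiring is a set $\mathcal{S}$ with addition and multiplication such that $\mathcal{S}$ is a commutative monoid under addition with identity $0_{\mathcal{S}}$, a semigroup under multiplication, multiplication distributes over addition on both sides, and $s0_{\mathcal{S}}=0_{\mathcal{S}}s=0_{\mathcal{S}}$ for all $s$. It is a semifield if $\mathcal{S}\setminus\{0_{\mathcal{S}}\}$ is an abelian group under multiplication (with identity $1_{\mathcal{S}}$). It is anti-negative if $a+b=0_{\mathcal{S}}$ implies $a=b=0_{\mathcal{S}}$. The boolean semifield is $\{0,1\}$ with $1+1=1$; the tropical semifield is $\mathbb{R}\cup\{-\infty\}$ with maximum as addition and ordinary addition as multiplication ($-\infty$ being the zero element). $M_n(\mathcal{S})$ is the set of $n\times n$ matrices over $\mathcal{S}$, viewed as a monoid under matrix multiplication and as an $\mathcal{S}$-module entrywise. $\mathcal{S}$-linear means additive and compatible with scalar multiplication. In the monoid $\mathcal{M}=M_n(\mathcal{S})$: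 $a\,\mathcal{R}\,b$ iff $a=bs$ and $b=at$ for some $s,t\in\mathcal{M}$; $a\,\mathcal{L}\,b$ iff $a=sb$ and $b=ta$ for some $s,t\in\mathcal{M}$; $a\,\mathcal{H}\,b$ iff $a\,\mathcal{R}\,b$ and $a\,\mathcal{L}\,b$; $a\,\mathcal{D}\,b$ iff there is $c\in\mathcal{M}$ with $a\,\mathcal{R}\,c$ and $c\,\mathcal{L}\,b$. $T$ preserves a relation $\mathcal{P}$ if $A\,\mathcal{P}\,B$ implies $T(A)\,\mathcal{P}\,T(B)$ for all $A,B\in M_n(\mathcal{S})$. A monomial matrix is one with exactly one non-zero entry in each row and in each column; over an anti-negative semifield the invertible matrices in $M_n(\mathcal{S})$ are precisely the monomial ones. *)

(* Defs.v *)
From HB Require Import structures.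
From mathcomp Require Import all_boot all_order all_algebra.

Set Implicit Arguments.
Unset Strict Implicit.
Unset Printing Implicit Defensive.

Import GRing.Theory.
Local Open Scope ring_scope.

(* A semifield is a [comNzSemiRingType] satisfying [semifield]: the structure
   already provides an absorbing 0, a commutative multiplication and an
   identity 1 <> 0, so what is left of "the nonzero elements form an abelian
   group" is the existence of inverses; closure of the nonzero elements under
   multiplication follows. *)
Definition semifield (S : comNzSemiRingType) : Prop :=
  forall x : S, x <> 0 -> exists y : S, x * y = 1.

Definition antinegative (S : nmodType) : Prop :=
  forall a b : S, a + b = 0 -> a = 0 /\ b = 0.

Definition invertible (S : comNzSemiRingType) (x : S) : Prop :=
  exists y : S, x * y = 1.

Definition units_have_sqrt (S : comNzSemiRingType) : Prop :=
  forall x : S, invertible x -> exists y : S, y ^+ 2 = x.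

(* [unitmx] is only available over rings with opposites and units. *)
Definition invertible_mx (S : pzSemiRingType) (n : nat) (P : 'M[S]_n) : Prop :=
  exists P' : 'M[S]_n, P *m P' = 1%:M /\ P' *m P = 1%:M.

Definition greenR (S : pzSemiRingType) (n : nat) (A B : 'M[S]_n) : Prop :=
  (exists X : 'M[S]_n, A = B *m X) /\ (exists Y : 'M[S]_n, B = A *m Y).

Definition greenL (S : pzSemiRingType) (n : nat) (A B : 'M[S]_n) : Prop :=
  (exists X : 'M[S]_n, A = X *m B) /\ (exists Y : 'M[S]_n, B = Y *m A).

Definition greenH (S : pzSemiRingType) (n : nat) (A B : 'M[S]_n) : Prop :=
  greenR A B /\ greenL A B.

Definition greenD (S : pzSemiRingType) (n : nat) (A B : 'M[S]_n) : Prop :=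
  exists C : 'M[S]_n, greenR A C /\ greenL C B.

Definition preserves (V : Type) (T : V -> V) (rel : V -> V -> Prop) : Prop :=
  forall A B : V, rel A B -> rel (T A) (T B).

(* Main.v *)
Require Import Defs.
From HB Require Import structures.
From mathcomp Require Import all_boot all_order all_algebra all_fingroup.
From mathcomp Require Import ring.

Set Implicit Arguments.
Unset Strict Implicit.
Unset Printing Implicit Defensive.

Import GRing.Theory.
Local Open Scope ring_scope.

(** Every map [X |-> P X Q] or [X |-> P X^T Q] with [P], [Q] invertible
    preserves H and D: multiplying by invertible matrices respects R and L,
    and transposition exchanges them, which is harmless because L o R = R o L.

    Conversely, let [T] be linear and bijective. Writing a unit matrix as a
    combination of images of unit matrices, nothing can cancel, by
    antinegativity, so that [T] permutes the unit matrices up to nonzero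
    weights ([bijective_weighted_reindexing]): the entry of [T X] in the cell
    [t] is [d t] times the entry of [X] in the cell [g t], for a permutation
    [g] of the n^2 cells. Two facts are wanted. First, [g] maps the pairs of
    cells in a common row or column ([collinear] pairs) onto such pairs; this
    forces [g (r, s)] to be [(a r, b s)] for all [r], [s], or [(b s, a r)] for
    all [r], [s] ([collinear_mono_grid]). Second, the matrix of the weights
    has rank one, [d (r, s) = p r * q s]; then [T] is the standard map given by
    the monomial matrices made of [p], [a] and of [q], [b]
    ([rank_le1_weights_standard]).

    If [T] preserves D, both facts hold because the D-class of a unit matrix
    contains the all-ones matrix and the sum of any two collinear unit
    matrices, while all its members have vanishing 2x2 minors, and [T] maps
    unit matrices to multiples of unit matrices: the minors of the image of
    the all-ones matrix are those of the weights, and two cells whose weighted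
    sum of unit matrices has vanishing minors are collinear.

    If [T] preserves H, these tests say nothing, since the H-class of a matrix
    of rank one consists of its nonzero multiples. The useful pairs are the
    matrices supported on a 2x2 submatrix
<<
       x y         y x
       y x   and   x y
>>
    which are H-related, as exchanging the two rows, or the two columns, maps
    each to the other. With [x = 1] and [y = 0] they show that [g] preserves
    collinearity ([greenH_preserver_collinear]), because H-related matrices
    have the same nonzero rows and columns. With [y = 1] and [x] chosen, by a
    square root, so that the image of the first matrix has proportional rows,
    the same proportion must hold in the image of the second one, and this
    makes the minor of the weights vanish ([greenH_preserver_rank_le1]). *)

(** * Semifields and antinegative sums *)

Lemma semifield_mulf_neq0 (S : comNzSemiRingType) (x y : S) :
  semifield S -> x != 0 -> y != 0 -> x * y != 0.
Proof.
move=> sfS /eqP/sfS [z xz1] /eqP y0; apply/eqP => xy0; apply: y0.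
by rewrite -[y]mul1r -xz1 mulrAC xy0 mul0r.
Qed.

Lemma semifield_mulfI (S : comNzSemiRingType) (x : S) :
  semifield S -> x != 0 -> injective ( *%R x).
Proof.
move=> sfS /eqP/sfS [z xz1] a b /(congr1 ( *%R z)).
by rewrite !mulrA (mulrC z) xz1 !mul1r.
Qed.

Lemma antinegative_sum_eq0 (V : nmodType) (I : finType) (F : I -> V) :
  antinegative V -> \sum_i F i = 0 -> forall i, F i = 0.
Proof. by move=> anV + i; rewrite (bigD1 i) //= => /anV []. Qed.

Lemma sum_neq0_exists (V : nmodType) (I : finType) (F : I -> V) :
  \sum_i F i != 0 -> exists i, F i != 0.
Proof.
move=> sF0; apply/existsP; apply: contraNT sF0 => /existsPn F0.
by apply/eqP/big1 => i _; apply/eqP/negbNE/F0.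
Qed.

(** * Green's relations under transposition and invertible factors *)

Lemma greenR_tr (S : comPzSemiRingType) (n : nat) (A B : 'M[S]_n) :
  greenR A B -> greenL A^T B^T.
Proof.
by case=> -[X AX] [Y BY]; split; [exists X^T | exists Y^T]; rewrite -trmx_mul; congr _^T.
Qed.

Lemma greenL_tr (S : comPzSemiRingType) (n : nat) (A B : 'M[S]_n) :
  greenL A B -> greenR A^T B^T.
Proof.
by case=> -[X AX] [Y BY]; split; [exists X^T | exists Y^T]; rewrite -trmx_mul; congr _^T.
Qed.

(** The two compositions of R and L agree: if [A = U C] and [B = C Z], then
    [A Z = U B] lies in the R-class of [A] and in the L-class of [B]. It makes
    D invariant under transposition. *)
Lemma greenL_R_D (S : pzSemiRingType) (n : nat) (A B C : 'M[S]_n) :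
  greenL A C -> greenR C B -> greenD A B.
Proof.
case=> -[U AU] [V CV] [[W CW] [Z BZ]].
have AZ : A *m Z = U *m B by rewrite AU BZ mulmxA.
exists (A *m Z); do 2!split.
- by exists W; rewrite AZ -mulmxA -CW.
- by exists Z.
- by exists U.
- by exists V; rewrite mulmxA -CV.
Qed.

Lemma greenH_tr (S : comPzSemiRingType) (n : nat) (A B : 'M[S]_n) :
  greenH A B -> greenH A^T B^T.
Proof. by case=> /greenR_tr LAB /greenL_tr. Qed.

Lemma greenD_tr (S : comPzSemiRingType) (n : nat) (A B : 'M[S]_n) :
  greenD A B -> greenD A^T B^T.
Proof. by case=> C [/greenR_tr LAC /greenL_tr RCB]; apply: greenL_R_D LAC RCB. Qed.

Lemma greenR_mul (S : pzSemiRingType) (n : nat) (P Q A B : 'M[S]_n) :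
  invertible_mx Q -> greenR A B -> greenR (P *m A *m Q) (P *m B *m Q).
Proof.
case=> Q' [QQ' _].
have mulQ (C E X : 'M[S]_n) : C = E *m X ->
    P *m C *m Q = P *m E *m Q *m (Q' *m X *m Q).
  move->; rewrite !mulmxA; do 2!congr (_ *m _).
  by rewrite -(mulmxA _ Q) QQ' mulmx1.
by case=> -[X AX] [Y BY]; split; [exists (Q' *m X *m Q) | exists (Q' *m Y *m Q)];
  apply: mulQ.
Qed.

Lemma greenL_mul (S : pzSemiRingType) (n : nat) (P Q A B : 'M[S]_n) :
  invertible_mx P -> greenL A B -> greenL (P *m A *m Q) (P *m B *m Q).
Proof.
case=> P' [_ P'P].
have mulP (C E X : 'M[S]_n) : C = X *m E ->
    P *m C *m Q = (P *m X *m P') *m (P *m E *m Q).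
  by move->; rewrite -!mulmxA (mulmxA P') P'P mul1mx.
by case=> -[X AX] [Y BY]; split; [exists (P *m X *m P') | exists (P *m Y *m P')];
  apply: mulP.
Qed.

Lemma greenH_mul (S : pzSemiRingType) (n : nat) (P Q A B : 'M[S]_n) :
  invertible_mx P -> invertible_mx Q ->
  greenH A B -> greenH (P *m A *m Q) (P *m B *m Q).
Proof. by move=> invP invQ [/(greenR_mul P invQ) ? /(greenL_mul Q invP)]. Qed.

Lemma greenD_mul (S : pzSemiRingType) (n : nat) (P Q A B : 'M[S]_n) :
  invertible_mx P -> invertible_mx Q ->
  greenD A B -> greenD (P *m A *m Q) (P *m B *m Q).
Proof.
move=> invP invQ [C [/(greenR_mul P invQ) RAC /(greenL_mul Q invP) LCB]].
by exists (P *m C *m Q).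
Qed.

(** * Vanishing 2x2 minors *)

(** Without subtraction, the vanishing of a minor is the equality of its two
    products. *)
Definition rank_le1 (S : pzSemiRingType) (m n : nat) (A : 'M[S]_(m, n)) : Prop :=
  forall i k j l, A i j * A k l = A i l * A k j.

Lemma rank_le1_tr (S : comPzSemiRingType) (m n : nat) (A : 'M[S]_(m, n)) :
  rank_le1 A -> rank_le1 A^T.
Proof. by move=> rkA i k j l; rewrite !mxE rkA mulrC. Qed.

Lemma rank_le1_mull (S : comPzSemiRingType) (m n p : nat)
    (X : 'M[S]_(m, n)) (A : 'M[S]_(n, p)) : rank_le1 A -> rank_le1 (X *m A).
Proof.
move=> rkA i k j l; rewrite !mxE !big_distrlr /=.
by apply: eq_bigr => a _; apply: eq_bigr => b _; rewrite mulrACA rkA mulrACA.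
Qed.

Lemma rank_le1_mulr (S : comPzSemiRingType) (m n p : nat)
    (A : 'M[S]_(m, n)) (X : 'M[S]_(n, p)) : rank_le1 A -> rank_le1 (A *m X).
Proof.
move=> rkA; rewrite -[A *m X]trmxK trmx_mul.
exact/rank_le1_tr/rank_le1_mull/rank_le1_tr.
Qed.

Lemma rank_le1_delta (S : pzSemiRingType) (m n : nat) (a : S) (i0 : 'I_m) (j0 : 'I_n) :
  rank_le1 (a *: delta_mx i0 j0).
Proof.
move=> i k j l; rewrite !mxE.
by do 4!case: eqP => _ //=; rewrite ?mulr0 ?mul0r.
Qed.

(** [A] is a product with [B] as a factor, and a 2x2 minor of a product is a
    combination of 2x2 minors of any one factor. *)
Lemma rank_le1_greenD (S : comPzSemiRingType) (n : nat) (A B : 'M[S]_n) :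
  greenD A B -> rank_le1 B -> rank_le1 A.
Proof.
case=> C [[[X ->] _] [[Y ->] _]] rkB.
exact/rank_le1_mulr/rank_le1_mull.
Qed.

Definition outer (S : pzSemiRingType) (m n : nat) (u : 'I_m -> S) (v : 'I_n -> S) :
  'M[S]_(m, n) := \matrix_(i, j) (u i * v j).

(** The intermediate matrix of the D-relation carries [u] in its column [j]
    and is 0 elsewhere. *)
Lemma outer_greenD_delta (S : pzSemiRingType) (n : nat) (u v : 'I_n -> S) (i j : 'I_n) :
  u i = 1 -> v j = 1 -> greenD (outer u v) (delta_mx i j).
Proof.
move=> ui vj; have selectl (a b : 'I_n -> S) k : a k = 1 ->
    delta_mx k k *m outer a b = outer (fun p => (p == k)%:R) b.
  move=> ak; apply/matrixP => p q; rewrite !mxE (bigD1 k) //= big1 => [|l lk].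
    by rewrite !mxE eqxx andbT ak mul1r addr0.
  by rewrite mxE (negPf lk) andbF mul0r.
have selectr (a b : 'I_n -> S) k : b k = 1 ->
    outer a b *m delta_mx k k = outer a (fun q => (q == k)%:R).
  move=> bk; apply/matrixP => p q; rewrite !mxE (bigD1 k) //= big1 => [|l lk].
    by rewrite !mxE eqxx bk mulr1 addr0.
  by rewrite !mxE (negPf lk) mulr0.
have mulouter (a b c : 'I_n -> S) k : b k = 1 ->
    outer a b *m outer (fun p => (p == k)%:R) c = outer a c.
  move=> bk; apply/matrixP => p q; rewrite !mxE (bigD1 k) //= big1 => [|l lk].
    by rewrite !mxE eqxx bk mulr1 mul1r addr0.
  by rewrite !mxE (negPf lk) mul0r mulr0.
have -> : delta_mx i j = outer (fun p => (p == i)%:R) (fun q => (q == j)%:R) :> 'M[S]_n.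
  by apply/matrixP => p q; rewrite !mxE -natrM mulnb.
exists (outer u (fun q => (q == j)%:R)); split; split.
- by exists (outer (fun p => (p == j)%:R) v); rewrite mulouter ?eqxx.
- by exists (delta_mx j j); rewrite selectr.
- by exists (outer u (fun q => (q == i)%:R)); rewrite mulouter ?eqxx.
- by exists (delta_mx i i); rewrite (selectl u).
Qed.

(** * Linear bijections permute the unit matrices up to weights *)

(** [g] goes from the cells of the image to the cells of the argument, so that
    entries of [T X] are read off without inverting a permutation. *)
Definition weighted_reindexing (S : pzSemiRingType) (n : nat)
    (T : 'M[S]_n -> 'M[S]_n) (g : 'I_n * 'I_n -> 'I_n * 'I_n) (d : 'I_n * 'I_n -> S) : Prop :=
  forall X t, T X t.1 t.2 = d t * X (g t).1 (g t).2.

(** The preimage [Y] of the unit matrix of [q] is a combination of unit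
    matrices, so that the images of those with a nonzero coefficient in [Y] sum
    up, with these coefficients, to a matrix supported in [q]. By
    antinegativity each of these images is supported in [q]; one of them is
    nonzero there. *)
Lemma bijective_weighted_reindexing (S : comNzSemiRingType) (n : nat)
    (T : 'M[S]_n -> 'M[S]_n) :
  semifield S -> antinegative S -> semilinear T -> bijective T ->
  exists g (d : 'I_n * 'I_n -> S),
    [/\ injective g, forall t, d t != 0 & weighted_reindexing T g d].
Proof.
move=> sfS anS [TZ TD] [U _ UK].
have T0 : T 0 = 0 by rewrite -(scale0r 0) TZ !scale0r.
have Tsum X : T X = \sum_(p : 'I_n * 'I_n) X p.1 p.2 *: T (delta_mx p.1 p.2).
  rewrite {1}[X]matrix_sum_delta pair_bigA (big_morph T TD T0).
  by apply: eq_bigr => p _; rewrite TZ.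
have Tdelta (q : 'I_n * 'I_n) : exists (pd : ('I_n * 'I_n) * S), pd.2 != 0 /\
    T (delta_mx pd.1.1 pd.1.2) = pd.2 *: delta_mx q.1 q.2.
  pose Y := U (delta_mx q.1 q.2).
  have entryE t : (t == q)%:R = \sum_p Y p.1 p.2 * T (delta_mx p.1 p.2) t.1 t.2.
    transitivity (T Y t.1 t.2); first by rewrite UK mxE; case: t q {Y} => [? ?] [].
    by rewrite Tsum summxE; apply: eq_bigr => p _; rewrite mxE.
  have [|p Tpq] := @sum_neq0_exists _ _ (fun p => Y p.1 p.2 * T (delta_mx p.1 p.2) q.1 q.2).
    by rewrite -entryE eqxx oner_neq0.
  exists (p, T (delta_mx p.1 p.2) q.1 q.2) => /=; split.
    by apply: contraNneq Tpq => ->; rewrite mulr0.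
  apply/matrixP => i j; rewrite !mxE.
  have [/eqP <-|tq] := boolP ((i, j) == q); first by rewrite !eqxx mulr1.
  have -> : (i == q.1) && (j == q.2) = false by case: q tq {Y entryE Tpq} => a b /negPf.
  rewrite mulr0; have := entryE (i, j); rewrite (negPf tq).
  move/esym/(antinegative_sum_eq0 anS)/(_ p) => /= YT0.
  apply: (semifield_mulfI (x := Y p.1 p.2) sfS); last by rewrite YT0 mulr0.
  by apply: contraNneq Tpq => ->; rewrite mul0r.
have [gd gdP] := fin_all_exists Tdelta.
pose g t := (gd t).1; pose d t := (gd t).2.
have d_neq0 t : d t != 0 by case: (gdP t).
have Tg t : T (delta_mx (g t).1 (g t).2) = d t *: delta_mx t.1 t.2 by case: (gdP t).
have g_inj : injective g.
  move=> s t gst; have := Tg s; rewrite gst Tg.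
  move/matrixP/(_ t.1 t.2); rewrite !mxE !eqxx mulr1 => dst.
  have := d_neq0 t; rewrite dst -xpair_eqE -!surjective_pairing.
  by have [->//|] := eqVneq t s; rewrite mulr0 eqxx.
exists g, d; split=> // X t.
rewrite Tsum summxE (reindex g) /=; last exact/onW_bij/injF_bij.
rewrite (bigD1 t) //= big1 => [|s st]; rewrite mxE Tg !mxE.
  by rewrite !eqxx mulr1 addr0 mulrC.
by rewrite -xpair_eqE -!surjective_pairing eq_sym (negPf st) !mulr0.
Qed.

(** * Permutations of a grid preserving collinearity *)

Definition collinear (I J : eqType) (p q : I * J) : bool :=
  (p.1 == q.1) || (p.2 == q.2).

(** The induced injection of [U * U] maps the finite graph of [r] into itself,
    hence onto itself. *)
Lemma injective_homo_mono (U : finType) (g : U -> U) (r : rel U) :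
  injective g -> {homo g : p q / r p q} -> {mono g : p q / r p q}.
Proof.
move=> g_inj g_r p q; apply/idP/idP; last exact: g_r.
pose gg (z : U * U) := (g z.1, g z.2); pose A := [set z : U * U | r z.1 z.2].
have gg_inj : injective gg by move=> [a b] [a' b'] [/g_inj-> /g_inj->].
have /eqP ggA : gg @: A == A.
  rewrite eqEcard card_imset // leqnn andbT.
  by apply/subsetP => _ /imsetP[z zA ->]; move: zA; rewrite !inE; apply: g_r.
move=> r_gpq; have : gg (p, q) \in gg @: A by rewrite ggA inE.
by case/imsetP => z zA /gg_inj pqz; move: zA; rewrite -pqz inE.
Qed.

(** A corner of the grid, that is a cell [p] with one neighbour [q] in its row
    and one [w] in its column, is sent to a corner, since [q] and [w] stay
    non-collinear. Hence if the edge [p q] stays horizontal, the edge [p w]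
    stays vertical, and conversely; from the single horizontal edge assumed
    here this propagates to the whole grid. *)
Lemma collinear_mono_rectangle (I : eqType) (x0 x1 : I) (g : I * I -> I * I) :
  x0 != x1 -> {mono g : p q / collinear p q} -> injective g ->
  (g (x0, x0)).1 = (g (x0, x1)).1 ->
  exists a b : I -> I, [/\ injective a, injective b & forall r s, g (r, s) = (a r, b s)].
Proof.
move=> x01 g_col g_inj row0.
have turn_col p q w : collinear p w -> ~~ collinear q w ->
    (g p).1 = (g q).1 -> (g p).2 = (g w).2.
  rewrite -!(g_col _ w) /collinear negb_or => /orP[/eqP pw|/eqP//] /andP[qw _] pq.
  by rewrite -pq pw eqxx in qw.
have turn_row p q w : collinear p w -> ~~ collinear q w ->
    (g p).2 = (g q).2 -> (g p).1 = (g w).1.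
  rewrite -!(g_col _ w) /collinear negb_or => /orP[/eqP//|/eqP pw] /andP[_ qw] pq.
  by rewrite -pq pw eqxx in qw.
have col0 r : (g (x0, x0)).2 = (g (r, x0)).2.
  have [->//|rx0] := eqVneq r x0.
  apply: (turn_col _ (x0, x1)) row0; rewrite /collinear /= ?eqxx ?orbT //.
  by rewrite eq_sym (negPf rx0) eq_sym.
have {}row0 s : (g (x0, x0)).1 = (g (x0, s)).1.
  have [->//|sx0] := eqVneq s x0.
  apply: (turn_row _ (x1, x0)) (col0 x1); rewrite /collinear /= ?eqxx //.
  by rewrite eq_sym (negPf x01) eq_sym.
pose a r := (g (r, x0)).1; pose b s := (g (x0, s)).2.
have gE r s : g (r, s) = (a r, b s).
  have [->|rx0] := eqVneq r x0; first by rewrite /a (row0 s) [LHS]surjective_pairing.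
  have [->|sx0] := eqVneq s x0; first by rewrite /b (col0 r) [LHS]surjective_pairing.
  rewrite [LHS]surjective_pairing; congr pair; symmetry.
    apply: (turn_row _ (x0, x0)) (esym (col0 r)); rewrite /collinear /= ?eqxx //.
    by rewrite eq_sym (negPf rx0) eq_sym.
  apply: (turn_col _ (x0, x0)) (esym (row0 s)); rewrite /collinear /= ?eqxx ?orbT //.
  by rewrite eq_sym (negPf rx0) eq_sym.
exists a, b; split=> // [r r' arr'|s s' bss'].
  by have /g_inj[] : g (r, x0) = g (r', x0) by rewrite !gE arr'.
by have /g_inj[] : g (x0, s) = g (x0, s') by rewrite !gE bss'.
Qed.

(** The second alternative is the first one applied to [g] followed by the
    exchange of the two coordinates. *)
Lemma collinear_mono_grid (n : nat) (g : 'I_n * 'I_n -> 'I_n * 'I_n) :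
  (0 < n)%N -> {mono g : p q / collinear p q} -> injective g ->
  exists a b : 'I_n -> 'I_n, [/\ injective a, injective b &
    (forall r s, g (r, s) = (a r, b s)) \/ (forall r s, g (r, s) = (b s, a r))].
Proof.
case: n g => [|[|n]] // g _ g_col g_inj.
  exists id, id; split=> //; left=> r s.
  by case: (g _) => u v; rewrite (ord1 u) (ord1 v) (ord1 (id r)) (ord1 (id s)).
have x01 : (ord0 : 'I_n.+2) != ord_max by [].
have : collinear (g (ord0, ord0)) (g (ord0, ord_max)) by rewrite g_col /collinear eqxx.
case/orP => /eqP row0.
  have [a [b [a_inj b_inj gE]]] := collinear_mono_rectangle x01 g_col g_inj row0.
  by exists a, b; split=> //; left.
pose h p := ((g p).2, (g p).1).
have h_col : {mono h : p q / collinear p q}.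
  by move=> p q; rewrite -(g_col p q) /collinear orbC.
have h_inj : injective h.
  move=> p q [E2 E1]; apply: g_inj.
  by rewrite [LHS]surjective_pairing E1 E2 -surjective_pairing.
have [a [b [a_inj b_inj hE]]] := collinear_mono_rectangle x01 h_col h_inj row0.
exists a, b; split=> //; right=> r s.
by have [<- <-] := hE r s; rewrite -surjective_pairing.
Qed.

(** * From weights of rank one to a standard map *)

(** The factors are the first column and the first row of [D], the latter
    divided by the corner entry. *)
Lemma rank_le1_factor (S : comNzSemiRingType) (n : nat) (D : 'M[S]_n) :
  semifield S -> (0 < n)%N -> (forall i j, D i j != 0) -> rank_le1 D ->
  exists p q : 'I_n -> S,
    [/\ forall i, p i != 0, forall j, q j != 0 & forall i j, D i j = p i * q j].
Proof.
move=> sfS n_gt0 D_neq0 rkD; pose o := Ordinal n_gt0.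
have [z Dz] := sfS _ (elimN eqP (D_neq0 o o)).
have z_neq0 : z != 0 by apply: contra_eqN Dz => /eqP->; rewrite mulr0 eq_sym oner_neq0.
exists (fun i => D i o), (fun j => z * D o j); split=> [i|j|i j] //.
  exact: semifield_mulf_neq0.
by rewrite mulrCA rkD mulrC -mulrA Dz mulr1.
Qed.

Definition monomial_mx (S : pzSemiRingType) (n : nat) (p : 'I_n -> S) (a : 'I_n -> 'I_n) :
  'M[S]_n := \matrix_(r, i) (p r *+ (i == a r)).

Lemma monomial_mx_invertible (S : comNzSemiRingType) (n : nat) (p : 'I_n -> S)
    (a : 'I_n -> 'I_n) :
  semifield S -> (forall r, p r != 0) -> injective a -> invertible_mx (monomial_mx p a).
Proof.
move=> sfS p_neq0 a_inj.
have [p' pp'] := fin_all_exists (fun r => sfS _ (elimN eqP (p_neq0 r))).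
exists (monomial_mx p' a)^T; split; apply/matrixP => i j; rewrite !mxE.
  rewrite (bigD1 (a i)) //= big1 => [|k ki]; rewrite !mxE ?(negPf ki) ?mul0r //.
  by rewrite eqxx addr0 mulrnAr (inj_eq a_inj); case: eqP => [->|]; rewrite ?pp'.
have [b _ bK] := injF_bij a_inj; rewrite -(bK i) -(bK j).
rewrite (bigD1 (b i)) //= big1 => [|k ki]; rewrite !mxE !(inj_eq a_inj).
  by rewrite eqxx addr0 mulrnAr mulrC eq_sym; case: eqP => [->|]; rewrite ?pp'.
by rewrite eq_sym (negPf ki) mul0r.
Qed.

Lemma mul_monomial_mx (S : pzSemiRingType) (m n : nat) (p : 'I_n -> S) (a : 'I_n -> 'I_n)
    (X : 'M[S]_(n, m)) r s : (monomial_mx p a *m X) r s = p r * X (a r) s.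
Proof.
rewrite mxE (bigD1 (a r)) //= big1 => [|k ka]; rewrite mxE ?(negPf ka) ?mul0r //.
by rewrite eqxx addr0.
Qed.

Lemma invertible_mx_tr (S : comPzSemiRingType) (n : nat) (P : 'M[S]_n) :
  invertible_mx P -> invertible_mx P^T.
Proof.
by case=> P' [PP' P'P]; exists P'^T; rewrite -!trmx_mul PP' P'P trmx1.
Qed.

Lemma rank_le1_weights_standard (S : comNzSemiRingType) (n : nat)
    (T : 'M[S]_n -> 'M[S]_n) (D : 'M[S]_n) (a b : 'I_n -> 'I_n) :
  semifield S -> (0 < n)%N -> injective a -> injective b ->
  (forall i j, D i j != 0) -> rank_le1 D ->
  (forall X r s, T X r s = D r s * X (a r) (b s)) ->
  exists P Q : 'M[S]_n,
    [/\ invertible_mx P, invertible_mx Q & forall X, T X = P *m X *m Q].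
Proof.
move=> sfS n_gt0 a_inj b_inj D_neq0 rkD TE.
have [p [q [p_neq0 q_neq0 Dpq]]] := rank_le1_factor sfS n_gt0 D_neq0 rkD.
exists (monomial_mx p a), (monomial_mx q b)^T; split.
- exact: monomial_mx_invertible.
- exact/invertible_mx_tr/monomial_mx_invertible.
move=> X; apply/matrixP => r s.
rewrite TE Dpq -mulmxA mul_monomial_mx -(trmxK (X *m _)) trmx_mul trmxK.
by rewrite [in RHS]mxE mul_monomial_mx mxE mulrA.
Qed.

(** * Preservers of H *)

(** The 2x2 pattern with [x] in the cells [a], [b] and [y] in the two other
    corners of the rectangle that they span. *)
Definition checker (S : pzSemiRingType) (n : nat) (a b : 'I_n * 'I_n) (x y : S) :
  'M[S]_n := \matrix_(r, s)
    if ((r, s) == a) || ((r, s) == b) then x else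
    if ((r, s) == (a.1, b.2)) || ((r, s) == (b.1, a.2)) then y else 0.

Lemma checker_greenH (S : pzSemiRingType) (n : nat) (a b : 'I_n * 'I_n) (x y : S) :
  ~~ collinear a b -> greenH (checker a b x y) (checker a b y x).
Proof.
case: a b => [i j] [k l]; rewrite /collinear /= negb_or => /andP[ik jl].
have ki : k != i by rewrite eq_sym.
have lj : l != j by rewrite eq_sym.
have rowE u v : checker (i, j) (k, l) u v = tperm_mx i k *m checker (i, j) (k, l) v u.
  rewrite -xrowE; apply/matrixP => r s; rewrite !mxE !xpair_eqE /=.
  case: tpermP => [->|->|/eqP/negPf-> /eqP/negPf->] //;
    rewrite !eqxx ?(negPf ik) ?(negPf ki) /= ?orbF;
    by have [->|_] := eqVneq s j; rewrite ?(negPf jl).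
have colE u v : checker (i, j) (k, l) u v = checker (i, j) (k, l) v u *m tperm_mx j l.
  rewrite -xcolE; apply/matrixP => r s; rewrite !mxE !xpair_eqE /=.
  case: tpermP => [->|->|/eqP/negPf-> /eqP/negPf->]; rewrite ?andbF //;
    rewrite !eqxx ?(negPf jl) ?(negPf lj) ?andbF ?andbT /= ?orbF;
    by have [->|_] := eqVneq r i; rewrite ?(negPf ik).
by split; split; [exists (tperm_mx j l) | exists (tperm_mx j l) |
  exists (tperm_mx i k) | exists (tperm_mx i k)].
Qed.

(** Suppose that [p], [q] are collinear but [g p], [g q] are not. The matrix
    with 1 in the cells [g p], [g q] is H-related to the one with 1 in the
    opposite corners of their rectangle. The image of the first is supported in
    [p] and [q]; the image of the second has the same nonzero rows and columns.
    As [p] and [q] are on one line, this confines it to [p] and [q] too, which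
    contradicts the injectivity of [g]. *)
Lemma greenH_preserver_collinear (S : comNzSemiRingType) (n : nat)
    (T : 'M[S]_n -> 'M[S]_n) (g : 'I_n * 'I_n -> 'I_n * 'I_n) (d : 'I_n * 'I_n -> S) :
  injective g -> (forall t, d t != 0) -> weighted_reindexing T g d ->
  preserves T (@greenH S n) -> {homo g : p q / collinear p q}.
Proof.
move=> g_inj d_neq0 TE TH p q pq; apply/negP => /negP ncol.
have [f fK gK] := injF_bij g_inj.
have [[_ [X TX]] [_ [Y TY]]] := TH _ _ (checker_greenH 1 0 ncol).
have supp i j : T (checker (g p) (g q) 1 0) i j != 0 -> (i, j) = p \/ (i, j) = q.
  rewrite (TE _ (i, j)) mxE -surjective_pairing !(inj_eq g_inj).
  have [->|_] := eqVneq (i, j) p; first by left.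
  have [->|_] := eqVneq (i, j) q; first by right.
  by rewrite /= if_same mulr0 eqxx.
move: (ncol); rewrite /collinear negb_or => /andP[rows cols].
(* A cell of the support of the image of the second matrix. *)
pose w := f ((g p).1, (g q).2).
have gw : g w = ((g p).1, (g q).2) by rewrite gK.
have wp : w != p.
  by apply: contraNneq cols => wp; move: gw; rewrite wp => ->.
have wq : w != q.
  by apply: contraNneq rows => wq; move: gw; rewrite wq => ->.
have Tw_neq0 : T (checker (g p) (g q) 0 1) w.1 w.2 != 0.
  rewrite TE mxE -surjective_pairing !(inj_eq g_inj) (negPf wp) (negPf wq) /=.
  by rewrite gw eqxx mulr1.
have [s Tws] : exists s, (w.1, s) = p \/ (w.1, s) = q.
  move: Tw_neq0; rewrite TX mxE => /sum_neq0_exists[s Tws]; exists s; apply: supp.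
  by apply: contraNneq Tws => ->; rewrite mul0r.
have [r Twr] : exists r, (r, w.2) = p \/ (r, w.2) = q.
  move: Tw_neq0; rewrite TY mxE => /sum_neq0_exists[r Twr]; exists r; apply: supp.
  by apply: contraNneq Twr => ->; rewrite mulr0.
have row_w : w.1 = p.1 \/ w.1 = q.1 by case: Tws => <-; [left|right].
have col_w : w.2 = p.2 \/ w.2 = q.2 by case: Twr => <-; [left|right].
rewrite [w]surjective_pairing [p]surjective_pairing xpair_eqE in wp.
rewrite [w]surjective_pairing [q]surjective_pairing xpair_eqE in wq.
move: pq wp wq; rewrite /collinear => /orP[] /eqP pq.
  by case: row_w col_w => -> [] ->; rewrite ?pq !eqxx.
by case: row_w col_w => -> [] ->; rewrite ?pq !eqxx.
Qed.

(** Take the 2x2 pattern with diagonal [y] and antidiagonal [1], where [y ^+ 2]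
    is the ratio of the two products in the minor of [D]: its image has
    proportional rows. Proportionality of rows is kept by multiplication on the
    right, so it holds in the image of the R-related pattern with diagonal [1]
    and antidiagonal [y]; there it reads
    [D i l * D k j * y = D k l * D i j * y]. *)
Lemma greenH_preserver_rank_le1 (S : comNzSemiRingType) (n : nat)
    (T : 'M[S]_n -> 'M[S]_n) (D : 'M[S]_n) (a b : 'I_n -> 'I_n) :
  semifield S -> units_have_sqrt S -> injective a -> injective b ->
  (forall i j, D i j != 0) -> (forall X r s, T X r s = D r s * X (a r) (b s)) ->
  preserves T (@greenH S n) -> rank_le1 D.
Proof.
move=> sfS sqS a_inj b_inj D_neq0 TE TH i k j l.
have [->|ik] := eqVneq i k; first by rewrite mulrC.
have [->//|jl] := eqVneq j l.
have DD_neq0 r s t u : D r s * D t u != 0 by apply: semifield_mulf_neq0.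
have [z uz] := sfS _ (elimN eqP (DD_neq0 i j k l)).
have [z' vz] := sfS _ (elimN eqP (DD_neq0 i l k j)).
have [|y y2] := sqS (z * (D i l * D k j)).
  by exists (D i j * D k l * z'); rewrite mulrACA vz mulr1 mulrC.
have uy2 : D i j * D k l * y ^+ 2 = D i l * D k j by rewrite y2 mulrA uz mul1r.
have y_neq0 : y != 0.
  by apply: contraTneq (DD_neq0 i l k j) => y0; rewrite -uy2 y0 expr0n mulr0 eqxx.
pose p := (a i, b j); pose q := (a k, b l).
have pq : ~~ collinear p q.
  by rewrite /collinear /= (inj_eq a_inj) (inj_eq b_inj) negb_or ik.
have [[_ [X TX]] _] := TH _ _ (checker_greenH y 1 pq).
have ki : k != i by rewrite eq_sym.
have lj : l != j by rewrite eq_sym.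
have TiE x x' s : T (checker p q x x') i s =
    D i s * if s == j then x else if s == l then x' else 0.
  rewrite TE mxE !xpair_eqE !(inj_eq a_inj) !(inj_eq b_inj).
  by rewrite eqxx (negPf ik) /= !orbF.
have TkE x x' s : T (checker p q x x') k s =
    D k s * if s == l then x else if s == j then x' else 0.
  rewrite TE mxE !xpair_eqE !(inj_eq a_inj) !(inj_eq b_inj).
  by rewrite eqxx (negPf ki) /=.
have prop s : D i l * T (checker p q y 1) k s = D k l * y * T (checker p q y 1) i s.
  rewrite TiE TkE; have [->|sl] := eqVneq s l.
    by rewrite (negPf lj); ring.
  have [->|_] := eqVneq s j; last by rewrite !mulr0.
  transitivity (D i j * D k l * y ^+ 2); [by rewrite uy2 mulr1 | ring].
have prop' : D i l * T (checker p q 1 y) k j = D k l * y * T (checker p q 1 y) i j.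
  rewrite TX !mxE !big_distrr /=; apply: eq_bigr => s _.
  by rewrite !mulrA prop.
move: prop'; rewrite TiE TkE eqxx (negPf jl) mulr1 => E.
apply: (semifield_mulfI sfS y_neq0).
transitivity (D k l * y * D i j); [ring | rewrite -E; ring].
Qed.

(** * Preservers of D *)

(** The matrix [outer u v] is D-related to a unit matrix, whose image is a
    multiple of a unit matrix. *)
Lemma greenD_preserver_rank_le1 (S : comNzSemiRingType) (n : nat)
    (T : 'M[S]_n -> 'M[S]_n) (g : 'I_n * 'I_n -> 'I_n * 'I_n) (d : 'I_n * 'I_n -> S)
    (u v : 'I_n -> S) (i j : 'I_n) :
  injective g -> weighted_reindexing T g d -> preserves T (@greenD S n) ->
  u i = 1 -> v j = 1 -> rank_le1 (T (outer u v)).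
Proof.
move=> g_inj TE TD ui vj.
apply: (rank_le1_greenD (TD _ _ (outer_greenD_delta ui vj))).
have [f _ gK] := injF_bij g_inj.
have -> : T (delta_mx i j) = d (f (i, j)) *: delta_mx (f (i, j)).1 (f (i, j)).2.
  apply/matrixP => r s; rewrite (TE _ (r, s)) !mxE /= -!xpair_eqE.
  rewrite -!surjective_pairing -[in LHS](gK (i, j)) (inj_eq g_inj).
  by case: eqP => [->|]; rewrite ?mulr0.
exact: rank_le1_delta.
Qed.

(** When [g p] and [g q] are collinear, the rectangle they span is the pair
    itself, so that its indicator matrix is an outer product; the image, which
    is supported in exactly [p] and [q], has vanishing minors. *)
Lemma greenD_preserver_collinear (S : comNzSemiRingType) (n : nat)
    (T : 'M[S]_n -> 'M[S]_n) (g : 'I_n * 'I_n -> 'I_n * 'I_n) (d : 'I_n * 'I_n -> S) :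
  semifield S -> injective g -> (forall t, d t != 0) -> weighted_reindexing T g d ->
  preserves T (@greenD S n) -> forall p q, collinear (g p) (g q) -> collinear p q.
Proof.
move=> sfS g_inj d_neq0 TE TD p q gpq.
pose u r : S := ((r == (g p).1) || (r == (g q).1))%:R.
pose v s : S := ((s == (g p).2) || (s == (g q).2))%:R.
have rk : rank_le1 (T (outer u v)).
  by apply: (@greenD_preserver_rank_le1 _ _ _ _ _ _ _ (g p).1 (g p).2 g_inj TE TD);
    rewrite /u /v eqxx.
have TuvE t : T (outer u v) t.1 t.2 = d t * ((t == p) || (t == q))%:R.
  rewrite TE mxE -natrM mulnb -(inj_eq g_inj t p) -(inj_eq g_inj t q); congr (_ * _%:R).
  move: gpq; rewrite /collinear; case: (g t) (g p) (g q) => [a b] [a1 b1] [a2 b2] /=.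
  by rewrite !xpair_eqE => /orP[] /eqP->; rewrite orbb -?andb_orr -?andb_orl.
have := rk p.1 q.1 p.2 q.2; rewrite (TuvE p) (TuvE q) (TuvE (p.1, q.2)).
rewrite !eqxx orbT !mulr1 => E; have := semifield_mulf_neq0 sfS (d_neq0 p) (d_neq0 q).
rewrite E /collinear; have [<- _|_] := eqVneq (p.1, q.2) p; first by rewrite eqxx orbT.
by have [<- _|_] := eqVneq (p.1, q.2) q; rewrite ?eqxx // mulr0 mul0r eqxx.
Qed.

(** * Characterization of the preservers *)

(** The weights [D] are the image of the all-ones matrix, which settles the case
    of D at once. *)
Lemma aligned_green_preserver_standard (S : comNzSemiRingType) (n : nat)
    (T : 'M[S]_n -> 'M[S]_n) (d : 'I_n * 'I_n -> S) (a b : 'I_n -> 'I_n) :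
  semifield S -> units_have_sqrt S -> (0 < n)%N -> injective a -> injective b ->
  (forall t, d t != 0) -> weighted_reindexing T (fun t => (a t.1, b t.2)) d ->
  preserves T (@greenH S n) \/ preserves T (@greenD S n) ->
  exists P Q : 'M[S]_n,
    [/\ invertible_mx P, invertible_mx Q & forall X, T X = P *m X *m Q].
Proof.
move=> sfS sqS n_gt0 a_inj b_inj d_neq0 TE TG.
pose D : 'M[S]_n := \matrix_(r, s) d (r, s).
have D_neq0 r s : D r s != 0 by rewrite mxE.
have TD X r s : T X r s = D r s * X (a r) (b s) by rewrite (TE _ (r, s)) mxE.
apply: (rank_le1_weights_standard sfS n_gt0 a_inj b_inj D_neq0 _ TD).
case: TG => [TH|TD'].
  exact: (greenH_preserver_rank_le1 sfS sqS a_inj b_inj D_neq0 TD TH).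
have -> : D = T (outer (fun=> 1) (fun=> 1)).
  by apply/matrixP => r s; rewrite TD [outer _ _ _ _]mxE !mulr1.
apply: (greenD_preserver_rank_le1 (i := Ordinal n_gt0) (j := Ordinal n_gt0) _ TE TD') => //.
by move=> [r s] [r' s'] /= [/a_inj-> /b_inj->].
Qed.

Lemma green_preserver_standard (S : comNzSemiRingType) (n : nat) (T : 'M[S]_n -> 'M[S]_n) :
  semifield S -> antinegative S -> units_have_sqrt S -> (0 < n)%N ->
  semilinear T -> bijective T ->
  preserves T (@greenH S n) \/ preserves T (@greenD S n) ->
  exists P Q : 'M[S]_n,
    [/\ invertible_mx P, invertible_mx Q &
        (forall X : 'M[S]_n, T X = P *m X *m Q) \/
        (forall X : 'M[S]_n, T X = P *m X^T *m Q)].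
Proof.
move=> sfS anS sqS n_gt0 T_lin T_bij TG.
have [g [d [g_inj d_neq0 TE]]] := bijective_weighted_reindexing sfS anS T_lin T_bij.
have g_col : {mono g : p q / collinear p q}.
  case: TG => [TH|TD].
    exact/injective_homo_mono/(greenH_preserver_collinear g_inj d_neq0 TE TH).
  (* Collinear images come from collinear cells, so it is the complementary
     relation that [g] is first seen to preserve. *)
  have ncol : {homo g : p q / ~~ collinear p q}.
    by move=> p q; apply/contraNN/(greenD_preserver_collinear sfS g_inj d_neq0 TE TD).
  move=> p q; apply: negb_inj.
  exact: (injective_homo_mono (r := fun p q => ~~ collinear p q)).
have [a [b [a_inj b_inj [gE|gE]]]] := collinear_mono_grid n_gt0 g_col g_inj.
  have TE' : weighted_reindexing T (fun t => (a t.1, b t.2)) d.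
    by move=> X [r s]; rewrite TE gE.
  have [P [Q [invP invQ TPQ]]] :=
    aligned_green_preserver_standard sfS sqS n_gt0 a_inj b_inj d_neq0 TE' TG.
  by exists P, Q; split=> //; left.
(* Precomposing with transposition turns this case into the aligned one. *)
have TE' : weighted_reindexing (fun X => T X^T) (fun t => (a t.1, b t.2)) d.
  by move=> X [r s]; rewrite TE gE mxE.
have [|P [Q [invP invQ TPQ]]] :=
    aligned_green_preserver_standard sfS sqS n_gt0 a_inj b_inj d_neq0 TE'.
  case: TG => [TH|TD]; [left => A B /greenH_tr|right => A B /greenD_tr]; [exact: TH|exact: TD].
by exists P, Q; split=> //; right=> X; rewrite -TPQ trmxK.
Qed.

Lemma standard_preserves_green (S : comPzSemiRingType) (n : nat) (T : 'M[S]_n -> 'M[S]_n) :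
  (exists P Q : 'M[S]_n,
    [/\ invertible_mx P, invertible_mx Q &
        (forall X : 'M[S]_n, T X = P *m X *m Q) \/
        (forall X : 'M[S]_n, T X = P *m X^T *m Q)]) ->
  preserves T (@greenH S n) /\ preserves T (@greenD S n).
Proof.
case=> P [Q [invP invQ [] TE]]; split=> A B.
- by rewrite !TE; apply: greenH_mul.
- by rewrite !TE; apply: greenD_mul.
- by rewrite !TE => /greenH_tr; apply: greenH_mul.
- by rewrite !TE => /greenD_tr; apply: greenD_mul.
Qed.

Theorem theorem4p4 (S : comNzSemiRingType)
    (semifieldS : semifield S) (antinegS : antinegative S)
    (sqrtS : units_have_sqrt S)
    (n : nat) (n_gt0 : (0 < n)%N)
    (T : 'M[S]_n -> 'M[S]_n) (T_lin : semilinear T) (T_bij : bijective T) :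
  (preserves T (@greenH S n) <->
     exists P Q : 'M[S]_n,
       [/\ invertible_mx P, invertible_mx Q &
           (forall X : 'M[S]_n, T X = P *m X *m Q) \/
           (forall X : 'M[S]_n, T X = P *m X^T *m Q)]) /\
  (preserves T (@greenH S n) <-> preserves T (@greenD S n)).
Proof.
have std := green_preserver_standard semifieldS antinegS sqrtS n_gt0 T_lin T_bij.
have back := @standard_preserves_green S n T.
by split; split=> [TG|TG]; [apply/std; left | case: (back TG) |
  case: (back (std (or_introl TG))) | case: (back (std (or_intror TG)))].
Qed.
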